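(* The homological Dehn function is a quasi-isometry invariant for groups of type $FP_2$: if $G$ and $H$ are quasi-isometric groups of type $FP_2$, then $\mathrm{FA}_G\simeq \mathrm{FA}_H$.
   Context: Homology is with $\mathbb{Z}$ coefficients. A group $H$ is of type $FP_2$ if there is an exact sequence $P_2\to P_1\to P_0\to\mathbb{Z}\to0$ of $\mathbb{Z}H$-modules with all $P_i$ finitely generated projective; such groups are finitely generated. Two finitely generated groups are quasi-isometric if they are quasi-isometric as metric spaces with word metrics for finite generating sets. Equivalence of functions: for $f,g\colon[0,\infty)\to[0,\infty)$ write $f\preceq g$ if there are constants $A,B>0$ and $C,D,E\ge 0$ with $f(n)\le A\,g(Bn+C)+Dn+E$ for all $n\ge0$; $f\simeq g$ means $f\preceq g$ and $g\preceq f$. Functions on $\mathbb{N}$ are extended to be constant on each $[n,n+1)$. A combinatorial complex is a CW complex in which each attaching map sends open cells of some combinatorial structure on the sphere homeomorphically onto open cells. If $X$ is a combinatorial complex with $H_1(X)=0$ and $\gamma$ is a cellular 1-cycle, then $\mathrm{HArea}_X(\gamma)=\min\{\sum|a_i| : \gamma=\partial\sum a_i\sigma_i\}$, where $a_i\in\mathbb{Z}$ and the $\sigma_i$ are 2-cells; $|\gamma|$ is the $\ell^1$-norm in $C_1(X)$; and $\mathrm{FA}_X(n)=\sup\{\mathrm{HArea}_X(\gamma) : \gamma \text{ a 1-cycle},\ |\gamma|\le n\}$. Homological Dehn function (homological filling function of a group): let $H$ be a group generated by a finite set $\mathcal{A}$, and let $R_0$ be a finite set of words in $F(\mathcal{A})$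 that are trivial in $H$. Let $X(\mathcal{A},R_0)$ be obtained from the Cayley graph $\Gamma(H,\mathcal{A})$ by attaching, for each $r\in R_0$ and each vertex $v$, a disk along the closed path starting at $v$ labeled $r$. The pair is a homological finite presentation of $H$ if $H_1(X(\mathcal{A},R_0))=0$. Such a presentation exists iff $H$ is of type $FP_2$, and then $\mathrm{FA}_H:=\mathrm{FA}_{X(\mathcal{A},R_0)}$, well defined up to $\simeq$. *)

(* Defs.v *)
From HB Require Import structures.
From mathcomp Require Import all_boot all_order all_algebra.
From mathcomp Require Import finmap monalg.
From mathcomp Require Import boolp classical_sets reals constructive_ereal ereal.
Set Implicit Arguments.
Unset Strict Implicit.
Unset Printing Implicit Defensive.
Import Order.TTheory GRing.Theory Num.Theory.
Local Open Scope ring_scope.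

Definition group_ring (G : groupType) : Type := {malg int[G]}.

(* The trivial module Z, on which every element of G acts as the identity. *)
Definition trivial_module (G : groupType) : Type := int.

Section GroupRing.
Variable G : groupType.
Implicit Types x y z : {malg int[G]}.
Local Open Scope fset_scope.
Local Open Scope ring_scope.

Definition grmul x y : {malg int[G]} :=
  \sum_(g <- msupp x) \sum_(h <- msupp y) << x@_g * y@_h *g (g * h)%g >>.

Definition grone : {malg int[G]} := << 1%g >>.

Lemma grmulw (d1 d2 : {fset G}) x y :
    msupp x `<=` d1 -> msupp y `<=` d2 ->
  grmul x y = \sum_(g <- d1) \sum_(h <- d2) << x@_g * y@_h *g (g * h)%g >>.
Proof.
move=> le1 le2; rewrite /grmul (big_fset_incl _ le1) /=.
  apply/eq_bigr=> g _; apply/big_fset_incl => // h _ /mcoeff_outdom ->.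
  by rewrite mulr0 monalgU0.
move=> g _ /mcoeff_outdom xg.
by rewrite big1 => // h _; rewrite xg mul0r monalgU0.
Qed.

Lemma grmulUg c g y :
  grmul << c *g g >> y = \sum_(h <- msupp y) << c * y@_h *g (g * h)%g >>.
Proof.
rewrite (grmulw msuppU_le (fsubset_refl _)) big_seq_fset1.
by apply/eq_bigr => h _; rewrite mcoeffUU.
Qed.

Lemma grmulgU c g x :
  grmul x << c *g g >> = \sum_(h <- msupp x) << x@_h * c *g (h * g)%g >>.
Proof.
rewrite (grmulw (fsubset_refl _) msuppU_le); apply/eq_bigr => h _.
by rewrite big_seq_fset1 mcoeffUU.
Qed.

Lemma grmulUU c1 c2 g h :
  grmul << c1 *g g >> << c2 *g h >> = << c1 * c2 *g (g * h)%g >>.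
Proof. by rewrite (grmulw msuppU_le msuppU_le) !big_seq_fset1 !mcoeffUU. Qed.

Lemma grmulEl x y : grmul x y = \sum_(g <- msupp x) grmul << x@_g *g g >> y.
Proof. by apply/eq_bigr=> g _; rewrite grmulUg. Qed.

Lemma grmulEr x y : grmul x y = \sum_(h <- msupp y) grmul x << y@_h *g h >>.
Proof.
rewrite {1}/grmul exchange_big; apply/eq_bigr=> h _; by rewrite grmulgU.
Qed.

Lemma grmul1g : left_id grone grmul.
Proof.
move=> x; rewrite grmulUg [RHS]monalgE.
by apply/eq_bigr=> g _; rewrite mul1r mul1g.
Qed.

Lemma grmulg1 : right_id grone grmul.
Proof.
move=> x; rewrite grmulgU [RHS]monalgE.
by apply/eq_bigr=> g _; rewrite mulr1 mulg1.
Qed.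

Lemma grmulDl : left_distributive grmul +%R.
Proof.
move=> x y z.
rewrite (grmulw (msuppD_le x y) (fsubset_refl _)).
rewrite (grmulw (fsubsetUl (msupp x) (msupp y)) (fsubset_refl _)).
rewrite (grmulw (fsubsetUr (msupp x) (msupp y)) (fsubset_refl _)).
rewrite -big_split /=; apply/eq_bigr=> g _.
rewrite -big_split /=; apply/eq_bigr=> h _.
by rewrite mcoeffD mulrDl monalgUD.
Qed.

Lemma grmulDr : right_distributive grmul +%R.
Proof.
move=> z x y.
rewrite (grmulw (fsubset_refl _) (msuppD_le x y)).
rewrite (grmulw (fsubset_refl _) (fsubsetUl (msupp x) (msupp y))).
rewrite (grmulw (fsubset_refl _) (fsubsetUr (msupp x) (msupp y))).
rewrite -big_split /=; apply/eq_bigr=> g _.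
rewrite -big_split /=; apply/eq_bigr=> h _.
by rewrite mcoeffD mulrDr monalgUD.
Qed.

Lemma grmul0g : left_zero 0 grmul.
Proof. by move=> x; rewrite /grmul msupp0 big_seq_fset0. Qed.

Lemma grmulg0 : right_zero 0 grmul.
Proof.
by move=> x; rewrite /grmul big1 // => g _; rewrite msupp0 big_seq_fset0.
Qed.

Lemma grmulA : associative grmul.
Proof.
move=> x y z.
rewrite [RHS](big_morph (grmul^~ _) (fun _ _ => grmulDl _ _ _) (grmul0g _)).
rewrite grmulEl; apply/eq_bigr=> g _.
rewrite [LHS](big_morph (grmul _) (fun _ _ => grmulDr _ _ _) (grmulg0 _)).
rewrite [RHS](big_morph (grmul^~ _) (fun _ _ => grmulDl _ _ _) (grmul0g _)).
apply/eq_bigr=> h _.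
rewrite [LHS](big_morph (grmul _) (fun _ _ => grmulDr _ _ _) (grmulg0 _)).
by rewrite grmulEr; apply/eq_bigr=> k _; rewrite !grmulUU mulrA mulgA.
Qed.

Lemma grone_neq0 : grone != 0.
Proof. by rewrite /grone monalgU_eq0 oner_eq0. Qed.

HB.instance Definition _ := GRing.Zmodule.copy (group_ring G) {malg int[G]}.
HB.instance Definition _ := GRing.Zmodule_isNzRing.Build (group_ring G)
  grmulA grmul1g grmulg1 grmulDl grmulDr grone_neq0.

Definition augmentation (x : group_ring G) : int := \sum_(g <- msupp x) x@_g.

Lemma augmentationw (d : {fset G}) (x : group_ring G) :
  msupp x `<=` d -> augmentation x = \sum_(g <- d) x@_g.
Proof.
by move=> le; apply: big_fset_incl => // g _ /mcoeff_outdom.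
Qed.

Lemma augmentationU c g : augmentation << c *g g >> = c.
Proof. by rewrite (augmentationw msuppU_le) big_seq_fset1 mcoeffUU. Qed.

Lemma augmentationD : {morph augmentation : x y / x + y}.
Proof.
move=> x y; rewrite (augmentationw (msuppD_le x y)).
rewrite (augmentationw (fsubsetUl (msupp x) (msupp y))).
rewrite (augmentationw (fsubsetUr (msupp x) (msupp y))).
by rewrite -big_split /=; apply/eq_bigr=> g _; rewrite mcoeffD.
Qed.

Lemma augmentation0 : augmentation 0 = 0.
Proof. by rewrite /augmentation msupp0 big_seq_fset0. Qed.

Lemma augmentation1 : augmentation 1 = 1.
Proof. exact: augmentationU. Qed.

Lemma augmentationM : {morph augmentation : x y / x * y}.
Proof.
move=> x y; rewrite -[x * y]/(grmul x y) /grmul.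
rewrite (big_morph _ augmentationD augmentation0) mulr_suml.
apply/eq_bigr=> g _.
rewrite (big_morph _ augmentationD augmentation0) mulr_sumr.
by apply/eq_bigr=> h _; rewrite augmentationU.
Qed.

HB.instance Definition _ := GRing.Zmodule.copy (trivial_module G) int.

Definition trivial_scale (x : group_ring G) (n : trivial_module G) :
  trivial_module G := augmentation x * (n : int).

Lemma trivial_scaleA (x y : group_ring G) n :
  trivial_scale x (trivial_scale y n) = trivial_scale (x * y) n.
Proof. by rewrite /trivial_scale augmentationM mulrA. Qed.

Lemma trivial_scale1 : left_id 1 trivial_scale.
Proof. by move=> n; rewrite /trivial_scale augmentation1 mul1r. Qed.

Lemma trivial_scaleDr : right_distributive trivial_scale +%R.
Proof. by move=> x m n; rewrite /trivial_scale mulrDr. Qed.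

Lemma trivial_scaleDl n : {morph trivial_scale^~ n : x y / x + y}.
Proof. by move=> x y; rewrite /trivial_scale augmentationD mulrDl. Qed.

HB.instance Definition _ := GRing.Zmodule_isLmodule.Build (group_ring G)
  (trivial_module G) trivial_scaleA trivial_scale1 trivial_scaleDr trivial_scaleDl.

End GroupRing.

Section FP2.

Definition surjective (S T : Type) (f : S -> T) : Prop :=
  forall y, exists x, f x = y.

Definition exact_at (S T : Type) (U : zmodType) (f : S -> T) (g : T -> U) :
  Prop := forall y, g y = 0 <-> exists x, f x = y.

Definition finitely_generated_module (S : nzRingType) (M : lmodType S) : Prop :=
  exists (n : nat) (e : 'I_n -> M),
    forall x, exists c : 'I_n -> S, x = \sum_(i < n) c i *: e i.

Definition projective_module (S : nzRingType) (P : lmodType S) : Prop :=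
  forall (M N : lmodType S) (p : {linear M -> N}) (f : {linear P -> N}),
    surjective p -> exists g : {linear P -> M}, forall x, p (g x) = f x.

Definition type_FP2 (G : groupType) : Prop :=
  exists (P0 P1 P2 : lmodType (group_ring G))
         (d2 : {linear P2 -> P1}) (d1 : {linear P1 -> P0})
         (eps : {linear P0 -> trivial_module G}),
    [/\ finitely_generated_module P0 /\ projective_module P0,
        finitely_generated_module P1 /\ projective_module P1,
        finitely_generated_module P2 /\ projective_module P2 &
        [/\ exact_at d2 d1, exact_at d1 eps & surjective eps]].

End FP2.

Section Words.
Variables (G : groupType) (A : {fset G}).

(* Words over A are sequences of pairs (a, b), not assumed to be reduced;
   (a, false) is the formal inverse of (a, true), even if a^-1 lies in A. *)
Definition letter_val (x : A * bool) : G :=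
  if x.2 then val x.1 else ((val x.1)^-1)%g.

Definition word_val (w : seq (A * bool)) : G :=
  (\prod_(x <- w) letter_val x)%g.

Definition generates : Prop := surjective word_val.

(* The infimum is a minimum as soon as A generates G. *)
Definition word_dist (R : realType) (g h : G) : R :=
  inf [set (size w)%:R | w in [set w | word_val w = (g^-1 * h)%g]].

End Words.

Definition quasi_isometric_spaces (R : realType) (X Y : Type)
    (dX : X -> X -> R) (dY : Y -> Y -> R) : Prop :=
  exists (f : X -> Y) (K L : R),
    [/\ 1 <= K, 0 <= L,
        (forall x x', K^-1 * dX x x' - L <= dY (f x) (f x') <= K * dX x x' + L)
      & (forall y, exists x, dY (f x) y <= L)].

Definition quasi_isometric (R : realType) (G H : groupType) : Prop :=
  exists (A : {fset G}) (B : {fset H}),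
    [/\ generates A, generates B &
        quasi_isometric_spaces (word_dist A R) (word_dist B R)].

Section Walks.
Variables (V E : Type) (src tgt : E -> V).

(* (e, true) is the edge e traversed from src e to tgt e, and (e, false) is
   the same edge traversed backwards. *)
Fixpoint is_walk (v : V) (p : seq (E * bool)) (w : V) : Prop :=
  if p is (e, b) :: p' then
    v = (if b then src e else tgt e) /\
    is_walk (if b then tgt e else src e) p' w
  else v = w.

End Walks.

(* Only the 2-skeleton of a combinatorial complex is involved in H_1, homological
   areas and filling functions. *)
Record complex2 := Complex2 {
  vertex : choiceType;
  edge : choiceType;
  face : choiceType;
  src : edge -> vertex;
  tgt : edge -> vertex;
  attach : face -> seq (edge * bool);
  attach_closed : forall s, exists v, is_walk src tgt v (attach s) v
}.

Section Chains.
Variable X : complex2.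

Definition chain_norm (K : choiceType) (c : {malg int[K]}) : nat :=
  (\sum_(k <- msupp c) `|c@_k|)%N.

Definition walk_chain (p : seq (edge X * bool)) : {malg int[edge X]} :=
  \sum_(x <- p) (if x.2 then << x.1 >> else - << x.1 >>).

Definition boundary1 (c : {malg int[edge X]}) : {malg int[vertex X]} :=
  \sum_(e <- msupp c) (<< tgt e >> - << src e >>) *~ c@_e.

Definition boundary2 (c : {malg int[face X]}) : {malg int[edge X]} :=
  \sum_(s <- msupp c) walk_chain (attach s) *~ c@_s.

Definition cycle1 (z : {malg int[edge X]}) : Prop := boundary1 z = 0.

Definition H1_trivial : Prop :=
  forall z, cycle1 z -> exists c, boundary2 c = z.

(* HArea and FA take values in [0, +oo]: HArea z is +oo when z bounds no chain,
   and otherwise the infimum is attained, being over natural numbers. *)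
Definition HArea (R : realType) (z : {malg int[edge X]}) : \bar R :=
  ereal_inf [set (chain_norm c)%:R%:E | c in [set c | boundary2 c = z]].

Definition FA (R : realType) (n : nat) : \bar R :=
  ereal_sup [set HArea R z | z in [set z | cycle1 z /\ (chain_norm z <= n)%N]].

End Chains.

Record hpres_data (G : groupType) := HpresData {
  gens : {fset G};
  rels : {fset seq (gens * bool)};
  gens_generate : generates gens;
  rels_trivial : forall r, r \in rels -> word_val r = 1%g
}.

Section PresentationComplex.
Variables (G : groupType) (D : hpres_data G).
Local Notation A := (gens D).

(* The Cayley graph: the edge (g, a) goes from g to g * a. *)
Definition cayley_src (e : G * A) : G := e.1.
Definition cayley_tgt (e : G * A) : G := (e.1 * val e.2)%g.

Fixpoint cayley_walk (g : G) (w : seq (A * bool)) : seq ((G * A) * bool) :=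
  if w is (a, b) :: w' then
    let h := (g * letter_val (a, b))%g in
    ((if b then g else h, a), b) :: cayley_walk h w'
  else [::].

Lemma cayley_walkP g w :
  is_walk cayley_src cayley_tgt g (cayley_walk g w) (g * word_val w)%g.
Proof.
elim: w g => [|[a b] w IHw] g /=; first by rewrite /word_val big_nil mulg1.
have ->: (g * word_val ((a, b) :: w) = (g * letter_val (a, b)) * word_val w)%g.
  by rewrite /word_val big_cons mulgA.
case: b => /=; split=> //; try exact: IHw.
by rewrite /cayley_tgt /letter_val /= mulgVK.
Qed.

Definition presentation_attach (s : G * rels D) : seq ((G * A) * bool) :=
  cayley_walk s.1 (val s.2).

Lemma presentation_attach_closed (s : G * rels D) :
  exists v, is_walk cayley_src cayley_tgt v (presentation_attach s) v.
Proof.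
exists s.1; have := cayley_walkP s.1 (val s.2).
by rewrite (rels_trivial (valP s.2)) mulg1.
Qed.

Definition presentation_complex : complex2 :=
  Complex2 presentation_attach_closed.

End PresentationComplex.

Definition homological_finite_presentation (G : groupType) (D : hpres_data G) :
  Prop := H1_trivial (presentation_complex D).

Section Growth.
Variable R : realType.

Definition step_extension (f : nat -> \bar R) (x : R) : \bar R :=
  f (Num.truncn x).

Definition growth_le (f g : R -> \bar R) : Prop :=
  exists A B C D E : R,
    [/\ [/\ 0 < A, 0 < B, 0 <= C, 0 <= D & 0 <= E] &
        forall x, 0 <= x ->
          (f x <= A%:E * g (B * x + C)%R + (D * x + E)%:E)%E].

Definition growth_equiv (f g : R -> \bar R) : Prop :=
  growth_le f g /\ growth_le g f.

End Growth.

Definition homological_dehn (R : realType) (G : groupType) (D : hpres_data G) :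
  R -> \bar R := step_extension (FA (presentation_complex D) R).
Arguments homological_dehn R {G} D.

(* Main.v *)
Require Import Defs.
From mathcomp Require Import all_boot all_order all_algebra.
From mathcomp Require Import finmap monalg.
From mathcomp Require Import boolp classical_sets reals constructive_ereal ereal.
Set Implicit Arguments.
Unset Strict Implicit.
Unset Printing Implicit Defensive.
Import Order.TTheory GRing.Theory Num.Theory.

(** A quasi-isometry between the vertex sets of two Cayley complexes extends to
a chain map with bounded distortion, and a quasi-inverse gives a chain map back
that is boundedly chain homotopic to the inverse.  Chain maps with bounds carry
fillings to fillings, so homological areas are comparable.

In detail, let X and Y be the presentation complexes of G and H, let phi : G -> H
be a quasi-isometry and psi a quasi-inverse.  Since phi moves the endpoints of an
edge to points at bounded distance, edges of X can be sent to paths of bounded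
length of Y ([push1]), which gives a chain map f in degrees 0 and 1; psi gives f'
in the same way.  In degree 2 only f' is extended: it sends the boundary of a
face of Y to a closed path of bounded length in X.  Such a path bounds a chain of
bounded norm because, up to translation by G, there are finitely many of them
([loop_filling_bounded]); this is the one place where H_1(X) = 0 is used.  In
the same way each edge e of X spans, with its image f'(f(e)) and two short paths
joining the endpoints, a closed path of bounded length, hence has a filling h(e)
of bounded norm.  On a 1-cycle z the two side paths cancel and

  z = boundary (h(z)) + f'(f(z)).

If c fills f(z), then h(z) + f'(c) therefore fills z, and its norm is at most
M |c| + M |z| ([filling_pull_back]).  Taking c of least norm bounds FA_X in terms
of FA_Y, and exchanging the roles of G and H gives the other inequality. *)

Local Open Scope fset_scope.
Local Open Scope ring_scope.

(** * Linear extension and norms of chains *)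

Section LinearExtension.
Variables (K : choiceType) (V : zmodType).
Implicit Types (f : K -> V) (c : {malg int[K]}).

(** The boundary maps of a complex are by definition of this form, so that the
lemmas on [linext] apply to them up to conversion. *)
Definition linext f c : V := \sum_(k <- msupp c) f k *~ c@_k.

Lemma linextw (d : {fset K}) f c :
  msupp c `<=` d -> linext f c = \sum_(k <- d) f k *~ c@_k.
Proof.
by move=> le; apply: big_fset_incl => // k _ /mcoeff_outdom ->; rewrite mulr0z.
Qed.

Lemma linextD f : {morph linext f : c1 c2 / c1 + c2}.
Proof.
move=> c1 c2; rewrite (linextw _ (msuppD_le c1 c2)).
rewrite (linextw _ (fsubsetUl (msupp c1) (msupp c2))).
rewrite (linextw _ (fsubsetUr (msupp c1) (msupp c2))).
by rewrite -big_split /=; apply/eq_bigr => k _; rewrite mcoeffD mulrzDr.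
Qed.

Lemma linext0 f : linext f 0 = 0.
Proof. by rewrite /linext msupp0 big_seq_fset0. Qed.

Lemma linextN f : {morph linext f : c / - c}.
Proof.
by move=> c; apply: (addrI (linext f c)); rewrite -linextD !subrr linext0.
Qed.

Lemma linextB f : {morph linext f : c1 c2 / c1 - c2}.
Proof. by move=> c1 c2; rewrite linextD linextN. Qed.

Lemma linext_sum f (I : Type) (s : seq I) (F : I -> {malg int[K]}) :
  linext f (\sum_(i <- s) F i) = \sum_(i <- s) linext f (F i).
Proof. exact: (big_morph _ (linextD f) (linext0 f)). Qed.

Lemma linextU f k : linext f << k >> = f k.
Proof. by rewrite (linextw _ msuppU_le) big_seq_fset1 mcoeffUU. Qed.

Lemma eq_linext f1 f2 c : f1 =1 f2 -> linext f1 c = linext f2 c.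
Proof. by move=> e; apply/eq_bigr => k _; rewrite e. Qed.

Lemma linext_addf f1 f2 c :
  linext (fun k => f1 k + f2 k) c = linext f1 c + linext f2 c.
Proof. by rewrite /linext -big_split; apply/eq_bigr => k _; rewrite mulrzDl. Qed.

Lemma linext_oppf f c : linext (fun k => - f k) c = - linext f c.
Proof. by rewrite /linext -sumrN; apply/eq_bigr => k _; rewrite mulNrz. Qed.

End LinearExtension.

Lemma linext_id (K : choiceType) (c : {malg int[K]}) :
  linext (fun k => << k >>) c = c.
Proof.
rewrite [RHS]monalgE; apply/eq_bigr => k _.
apply/malgP => l; rewrite mcoeffU.
rewrite (raddfMz (mcoeff l)) /= mcoeffU.
by case: (k == l); rewrite ?mul0rz ?mulr1n ?mulr0n ?intz.
Qed.

Lemma linext_comp (K1 K2 : choiceType) (V : zmodType)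
    (f : K2 -> V) (h : K1 -> {malg int[K2]}) (c : {malg int[K1]}) :
  linext f (linext h c) = linext (fun k => linext f (h k)) c.
Proof.
rewrite [linext h c]/linext linext_sum; apply/eq_bigr => k _.
have linextMn n x : linext f (x *+ n) = linext f x *+ n.
  by elim: n => [|n IHn]; rewrite ?mulr0n ?linext0 // !mulrS linextD IHn.
case: (c@_k) => n; first by rewrite -!pmulrn linextMn.
by rewrite NegzE !mulrNz linextN -!pmulrn linextMn.
Qed.

Section ChainNorm.
Variable K : choiceType.
Implicit Types c : {malg int[K]}.

Lemma chain_normw (d : {fset K}) c :
  msupp c `<=` d -> chain_norm c = (\sum_(k <- d) `|c@_k|)%N.
Proof.
by move=> le; apply: big_fset_incl => // k _ /mcoeff_outdom ->.
Qed.

Lemma chain_norm0 : chain_norm (0 : {malg int[K]}) = 0%N.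
Proof. by rewrite /chain_norm msupp0 big_seq_fset0. Qed.

Lemma chain_normU (k : K) : chain_norm (<< k >> : {malg int[K]}) = 1%N.
Proof. by rewrite (chain_normw msuppU_le) big_seq_fset1 mcoeffUU. Qed.

Lemma chain_normN c : chain_norm (- c) = chain_norm c.
Proof.
by rewrite /chain_norm msuppN; apply/eq_bigr => k _; rewrite mcoeffN abszN.
Qed.

Lemma chain_normD c1 c2 :
  (chain_norm (c1 + c2)%R <= chain_norm c1 + chain_norm c2)%N.
Proof.
rewrite (chain_normw (msuppD_le c1 c2)).
rewrite (chain_normw (fsubsetUl (msupp c1) (msupp c2))).
rewrite (chain_normw (fsubsetUr (msupp c1) (msupp c2))).
rewrite -big_split /=; apply: leq_sum => k _.
by rewrite mcoeffD -lez_nat PoszD !abszE ler_normD.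
Qed.

Lemma chain_normMz c (n : int) : (chain_norm (c *~ n) <= `|n| * chain_norm c)%N.
Proof.
have normMn m : (chain_norm (c *+ m) <= m * chain_norm c)%N.
  elim: m => [|m IHm]; first by rewrite mulr0n chain_norm0.
  by rewrite mulrS mulSn (leq_trans (chain_normD _ _)) // leq_add2l.
case: n => n; first by rewrite -pmulrn normMn.
by rewrite NegzE mulrNz chain_normN -pmulrn normMn.
Qed.

End ChainNorm.

Lemma chain_norm_linext (K1 K2 : choiceType) (h : K1 -> {malg int[K2]})
    (M : nat) (c : {malg int[K1]}) :
  (forall k, (chain_norm (h k) <= M)%N) ->
  (chain_norm (linext h c) <= M * chain_norm c)%N.
Proof.
move=> le_hM; rewrite /linext [chain_norm c]/chain_norm big_distrr /=.
elim/big_rec2: _ => [|k m x _ le_xm]; first by rewrite chain_norm0.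
rewrite (leq_trans (chain_normD _ _)) // leq_add //.
by rewrite (leq_trans (chain_normMz _ _)) // mulnC leq_mul2r le_hM orbT.
Qed.

(** * Coarse geometry of word metrics *)

Section WordValues.
Variables (G : groupType) (A : {fset G}).
Implicit Types (w : seq (A * bool)) (g h : G).

Definition word_inv w : seq (A * bool) := rev [seq (x.1, ~~ x.2) | x <- w].

Lemma word_val_nil : word_val ([::] : seq (A * bool)) = 1%g.
Proof. by rewrite /word_val big_nil. Qed.

Lemma word_val_cons x w : word_val (x :: w) = (letter_val x * word_val w)%g.
Proof. by rewrite /word_val big_cons. Qed.

Lemma word_val_cat w1 w2 : word_val (w1 ++ w2) = (word_val w1 * word_val w2)%g.
Proof. by rewrite /word_val big_cat. Qed.

Lemma letter_valN (a : A) b : letter_val (a, ~~ b) = ((letter_val (a, b))^-1)%g.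
Proof. by case: b; rewrite /letter_val //= invgK. Qed.

Lemma word_inv_cons x w : word_inv (x :: w) = word_inv w ++ [:: (x.1, ~~ x.2)].
Proof. by rewrite /word_inv /= rev_cons -cats1. Qed.

Lemma word_val_inv w : word_val (word_inv w) = ((word_val w)^-1)%g.
Proof.
elim: w => [|[a b] w IHw]; first by rewrite word_val_nil invg1.
rewrite word_inv_cons word_val_cat IHw word_val_cons !word_val_cons word_val_nil.
by rewrite letter_valN mulg1 invgM.
Qed.

Lemma size_word_inv w : size (word_inv w) = size w.
Proof. by rewrite size_rev size_map. Qed.

(** A bound on the word distance that also provides a path; unlike [word_dist]
it is integral and meaningful without assuming that A generates. *)
Definition word_near (n : nat) g h : Prop :=
  exists w, word_val w = (g^-1 * h)%g /\ (size w <= n)%N.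

Lemma word_near_sym n g h : word_near n g h -> word_near n h g.
Proof.
move=> [w [w_val w_size]]; exists (word_inv w).
by rewrite word_val_inv w_val size_word_inv invgM invgK.
Qed.

Lemma word_near_trans m n g h k :
  word_near m g h -> word_near n h k -> word_near (m + n) g k.
Proof.
move=> [w1 [v1 s1]] [w2 [v2 s2]]; exists (w1 ++ w2).
by rewrite word_val_cat v1 v2 size_cat leq_add // mulgA mulgK.
Qed.

Lemma word_near_le m n g h : (m <= n)%N -> word_near m g h -> word_near n g h.
Proof. by move=> le_mn [w [v s]]; exists w; rewrite (leq_trans s). Qed.

Lemma word_near_gen g (a : A) : word_near 1 g (g * val a)%g.
Proof.
exists [:: (a, true)]; split=> //.
by rewrite word_val_cons word_val_nil mulg1 mulKg.
Qed.

Section Distance.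
Variable R : realType.

Lemma word_dist_le n g h : word_near n g h -> word_dist A R g h <= n%:R.
Proof.
move=> [w [w_val w_size]]; apply: (@le_trans _ _ (size w)%:R); last first.
  by rewrite ler_nat.
by apply: ge_inf; [exists 0 => _ [v _ <-] | exists w].
Qed.

(** The word metric is an infimum, so a word slightly longer than the distance is
what one gets; hence the bound r + 1 in place of r. *)
Lemma word_near_dist (r : R) : generates A ->
  exists n, forall g h, word_dist A R g h <= r -> word_near n g h.
Proof.
move=> gen; exists (Num.truncn (r + 1)) => g h dist_r.
have [w w_val] := gen (g^-1 * h)%g.
have nonempty : ([set ((size w)%:R : R) | w in
      [set w : seq (A * bool) | word_val w = (g^-1 * h)%g]] !=set0)%classic.
  by exists (size w)%:R; exists w.
have lt_r1 : word_dist A R g h < r + 1 by rewrite (le_lt_trans dist_r) ?ltrDl.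
have [_ [v v_val <-] lt_v] := inf_lt nonempty lt_r1.
exists v; split=> //.
have r1_ge0 : 0 <= r + 1 by rewrite (le_trans _ (ltW lt_v)).
by rewrite truncn_ge_nat // ltW.
Qed.

End Distance.
End WordValues.

(** Being at bounded word distance does not depend on the finite generating set:
each letter over A is rewritten as a word over B, of length at most M. *)
Lemma word_near_change (G : groupType) (A B : {fset G}) : generates B ->
  forall n, exists m, forall g h : G, word_near A n g h -> word_near B m g h.
Proof.
move=> genB.
have near_gen (x : A * bool) :
    exists k, forall g : G, word_near B k g (g * letter_val x)%g.
  have [w w_val] := genB (letter_val x).
  by exists (size w) => g; exists w; rewrite w_val mulKg.
have [k kP] := choice near_gen; pose M := (\max_x k x)%N.
move=> n; exists (n * M)%N => g h [w []].
elim: n w g => [|n IHn] [|x w] g //=.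
- by rewrite word_val_nil => e _; exists [::]; rewrite word_val_nil.
- by rewrite word_val_nil => e _; exists [::]; rewrite word_val_nil.
rewrite word_val_cons ltnS mulSn => e le_wn.
apply: (@word_near_trans _ _ _ _ _ (g * letter_val x)%g).
  by apply: word_near_le (kP x g); apply: leq_bigmax.
by apply: (IHn w) => //; rewrite invgM -mulgA -e mulKg.
Qed.

(** For a map defined on the vertices of a Cayley graph, a bound on the images of
edges is the same as being coarsely Lipschitz. *)
Definition word_lipschitz (G H : groupType) (A : {fset G}) (B : {fset H})
    (phi : G -> H) : Prop :=
  exists K, forall g (a : A), word_near B K (phi g) (phi (g * val a)%g).

Definition word_close (G : groupType) (A : {fset G}) (theta : G -> G) : Prop :=
  exists K, forall g, word_near A K (theta g) g.

(** The quasi-inverse psi picks a point whose image under phi is nearly the given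
one.  The lower bound in the definition of a quasi-isometry then says that points
with nearby images are close, which makes psi coarsely Lipschitz and makes
psi \o phi close to the identity. *)
Lemma quasi_isometry_words (R : realType) (G H : groupType)
    (A : {fset G}) (B : {fset H}) :
  generates A -> generates B -> quasi_isometric R G H ->
  exists (phi : G -> H) (psi : H -> G),
    [/\ word_lipschitz A B phi, word_lipschitz B A psi,
        word_close A (psi \o phi) & word_close B (phi \o psi)].
Proof.
move=> genA genB [A0 [B0 [genA0 genB0 [phi [K [L [K1 L0 distP coverP]]]]]]].
have K_gt0 : 0 < K by rewrite (lt_le_trans _ K1).
have [psi psiP] := choice coverP.
have nearG n : exists m, forall g g', word_near A n g g' ->
    word_near B m (phi g) (phi g').
  have [l lP] := word_near_change A genA0 n.
  have [m mP] := word_near_dist (K * l%:R + L) genB0.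
  have [m' m'P] := word_near_change B0 genB m.
  exists m' => g g' /lP /(word_dist_le R) near_gg'; apply/m'P/mP.
  have /andP[_ /le_trans->] // := distP g g'.
  by rewrite lerD2r ler_wpM2l // ltW.
have nearG' n : exists m, forall g g', word_near B n (phi g) (phi g') ->
    word_near A m g g'.
  have [l lP] := word_near_change B genB0 n.
  have [m mP] := word_near_dist (K * (l%:R + L)) genA0.
  have [m' m'P] := word_near_change A0 genA m.
  exists m' => g g' /lP /(word_dist_le R) near_gg'; apply/m'P/mP.
  have /andP[le_d _] := distP g g'.
  rewrite -ler_pdivrMl // -lerBlDr.
  exact: le_trans le_d near_gg'.
have [N NP] : word_close B (phi \o psi).
  have [m mP] := word_near_dist L genB0.
  have [m' m'P] := word_near_change B0 genB m.
  by exists m' => h; apply/m'P/mP/psiP.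
exists phi, psi; split; last by exists N.
- by have [m mP] := nearG 1%N; exists m => g a; apply/mP/word_near_gen.
- have [m mP] := nearG' (N + 1 + N)%N; exists m => h b; apply: mP.
  apply: word_near_trans (word_near_sym (NP _)).
  exact: word_near_trans (NP _) (word_near_gen _ _).
- by have [m mP] := nearG' N; exists m => g; apply: mP; apply: NP.
Qed.

(** * Chains of paths in the Cayley graph *)

Section PathChains.
Variables (G : groupType) (D : hpres_data G).
Local Notation A := (gens D).
Implicit Types (w : seq (A * bool)) (g h : G).

Definition path_chain g w : {malg int[(G * A)%type]} :=
  \sum_(x <- cayley_walk g w) (if x.2 then << x.1 >> else - << x.1 >>).

Definition cayley_boundary : {malg int[(G * A)%type]} -> {malg int[G]} :=
  linext (fun e => << cayley_tgt e >> - << cayley_src e >>).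

Lemma path_chain_nil g : path_chain g [::] = 0.
Proof. by rewrite /path_chain big_nil. Qed.

Lemma path_chain_cons g a b w :
  path_chain g ((a, b) :: w) =
  (if b then << (g, a) >> else - << ((g * (val a)^-1)%g, a) >>)
  + path_chain (g * letter_val (a, b))%g w.
Proof. by rewrite /path_chain /= big_cons; case: b. Qed.

Lemma path_chain_letter g a : path_chain g [:: (a, true)] = << (g, a) >>.
Proof. by rewrite path_chain_cons path_chain_nil addr0. Qed.

Lemma path_chain_cat g w1 w2 :
  path_chain g (w1 ++ w2) = path_chain g w1 + path_chain (g * word_val w1)%g w2.
Proof.
elim: w1 g => [|[a b] w1 IHw] g.
  by rewrite path_chain_nil add0r word_val_nil mulg1.
by rewrite cat_cons !path_chain_cons IHw word_val_cons addrA mulgA.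
Qed.

Lemma path_chain_inv g w :
  path_chain (g * word_val w)%g (word_inv w) = - path_chain g w.
Proof.
elim: w g => [|[a b] w IHw] g.
  by rewrite !path_chain_nil oppr0.
rewrite word_inv_cons path_chain_cat word_val_cons mulgA IHw word_val_inv mulgK.
rewrite !path_chain_cons path_chain_nil addr0 opprD addrC; congr (_ + _).
by case: b; rewrite /letter_val /= ?mulgK ?opprK.
Qed.

Lemma chain_norm_path_chain g w : (chain_norm (path_chain g w) <= size w)%N.
Proof.
elim: w g => [|[a b] w IHw] g; first by rewrite path_chain_nil chain_norm0.
rewrite path_chain_cons (leq_trans (chain_normD _ _)) //= -add1n leq_add //.
by case: b; rewrite ?chain_normN chain_normU.
Qed.

(** The boundaries of the edges of a path telescope. *)
Lemma cayley_boundary_path_chain g w :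
  cayley_boundary (path_chain g w) = << (g * word_val w)%g >> - << g >>.
Proof.
rewrite /cayley_boundary; elim: w g => [|[a b] w IHw] g.
  by rewrite path_chain_nil linext0 word_val_nil mulg1 subrr.
rewrite path_chain_cons linextD IHw word_val_cons mulgA addrC.
rewrite -[RHS](subrKA << (g * letter_val (a, b))%g >>); congr (_ + _).
by case: b; rewrite /letter_val ?linextN linextU /cayley_tgt /cayley_src //=
  mulgVK opprB.
Qed.

End PathChains.

(** * Maps of chains induced by maps of vertices *)

Section PushForward.
Variables (G H : groupType) (D : hpres_data G) (D' : hpres_data H).
Local Notation A := (gens D).
Local Notation B := (gens D').
Variables (phi : G -> H) (u : G * A -> seq (B * bool)) (K : nat).
Hypothesis u_val : forall e,
  word_val (u e) = ((phi (cayley_src e))^-1 * phi (cayley_tgt e))%g.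
Hypothesis u_size : forall e, (size (u e) <= K)%N.

(** The degree-one part of the chain map that extends phi: an edge e goes to the
path labelled by the chosen word u e between the images of its endpoints. *)
Definition push1 : {malg int[(G * A)%type]} -> {malg int[(H * B)%type]} :=
  linext (fun e => path_chain (phi (cayley_src e)) (u e)).

Lemma chain_norm_push1 z : (chain_norm (push1 z) <= K * chain_norm z)%N.
Proof.
apply: chain_norm_linext => e.
exact: leq_trans (chain_norm_path_chain _ _) (u_size e).
Qed.

(** [push1] commutes with the boundary, so it maps cycles to cycles. *)
Lemma cayley_boundary_push1 z :
  cayley_boundary (push1 z) = linext (fun g => << phi g >>) (cayley_boundary z).
Proof.
rewrite /cayley_boundary !linext_comp; apply: eq_linext => e.
have := cayley_boundary_path_chain (phi (cayley_src e)) (u e).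
by rewrite /cayley_boundary => ->; rewrite u_val mulVKg linextB !linextU.
Qed.

(** The image of a path is again the chain of a path: the words u e, inverted for
the edges traversed backwards, are concatenated.  Thus images of closed paths are
closed paths, to which uniform filling bounds for short loops apply. *)
Lemma push1_path_chain g w : exists w',
  [/\ word_val w' = ((phi g)^-1 * phi (g * word_val w)%g)%g,
      (size w' <= K * size w)%N &
      push1 (path_chain g w) = path_chain (phi g) w'].
Proof.
elim: w g => [|[a b] w IHw] g.
  exists [::]; rewrite !word_val_nil mulg1 mulVg muln0.
  by split; rewrite // /push1 !path_chain_nil linext0.
have [w' [w'_val w'_size push_w]] := IHw (g * letter_val (a, b))%g.
have [v [v_val v_size push_v]] : exists v,
    [/\ word_val v = ((phi g)^-1 * phi (g * letter_val (a, b))%g)%g,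
        (size v <= K)%N &
        push1 (if b then << (g, a) >> else - << ((g * (val a)^-1)%g, a) >>) =
        path_chain (phi g) v].
  case: b {w' w'_val w'_size push_w}; rewrite /letter_val /=.
    by exists (u (g, a)); rewrite u_val /push1 linextU.
  set e := ((g * (val a)^-1)%g, a).
  have u_end : phi g = (phi (cayley_src e) * word_val (u e))%g.
    by rewrite u_val mulVKg /cayley_tgt /= mulgVK.
  exists (word_inv (u e)); rewrite size_word_inv; split=> //.
    by rewrite word_val_inv u_end invgM mulgVK.
  by rewrite u_end path_chain_inv /push1 linextN linextU.
exists (v ++ w'); split.
- by rewrite word_val_cat v_val w'_val word_val_cons mulgA mulgK -mulgA.
- by rewrite size_cat mulnS leq_add.
- rewrite path_chain_cons path_chain_cat v_val mulVKg -push_v -push_w.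
  exact: linextD.
Qed.

End PushForward.

(** * Filling short loops *)

Lemma bounded_on_short_words (T : finType) (F : seq T -> nat) (N : nat) :
  exists M, forall w, (size w <= N)%N -> (F w <= M)%N.
Proof.
elim: N F => [|N IHN] F; first by exists (F [::]) => -[].
have [M MP] := choice (fun x : T => IHN (fun w => F (x :: w))).
exists (maxn (F [::]) (\max_x M x)) => -[|x w] le_wN; first exact: leq_maxl.
rewrite (leq_trans _ (leq_maxr _ _)) // (leq_trans (MP x w le_wN)) //.
exact: leq_bigmax.
Qed.

Section Filling.
Variables (G : groupType) (D : hpres_data G).
Local Notation A := (gens D).
Local Notation X := (presentation_complex D).

(** This is [boundary2] of the presentation complex, with chains indexed by
G * rels D so that G visibly acts on them. *)
Definition relator_boundary : {malg int[(G * rels D)%type]} ->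
    {malg int[(G * A)%type]} :=
  linext (fun s => path_chain s.1 (val s.2)).

Lemma boundary1_presentation (z : {malg int[edge X]}) :
  boundary1 z = cayley_boundary z.
Proof. by []. Qed.

Definition translate (S : choiceType) (g : G) :
    {malg int[(G * S)%type]} -> {malg int[(G * S)%type]} :=
  linext (fun x => << ((g * x.1)%g, x.2) >>).

Lemma translate_path_chain g h (w : seq (A * bool)) :
  translate g (path_chain h w) = path_chain (g * h)%g w.
Proof.
rewrite /translate; elim: w h => [|[a b] w IHw] h.
  by rewrite !path_chain_nil linext0.
rewrite !path_chain_cons linextD IHw mulgA; congr (_ + _).
by case: b; rewrite ?linextN linextU //= mulgA.
Qed.

Lemma relator_boundary_translate g c :
  relator_boundary (translate g c) = translate g (relator_boundary c).
Proof.
rewrite /relator_boundary /translate !linext_comp; apply: eq_linext => s.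
by rewrite linextU /= -translate_path_chain.
Qed.

(** Up to translation there are finitely many closed paths of length at most N,
one for each trivial word.  Each bounds some chain since H_1 vanishes, and
translation is norm preserving, so that the largest of the finitely many chosen
norms bounds all of them. *)
Lemma loop_filling_bounded (presD : homological_finite_presentation D) N :
  exists M, forall g (w : seq (A * bool)),
    (size w <= N)%N -> word_val w = 1%g ->
    exists c, relator_boundary c = path_chain g w /\ (chain_norm c <= M)%N.
Proof.
have fill w : exists c, word_val w = 1%g ->
    relator_boundary c = path_chain 1%g w.
  have [w1|] := pselect (word_val w = 1%g); last by exists 0.
  have cycle_w : cycle1 (X := X) (path_chain 1%g w).
    rewrite /cycle1 boundary1_presentation.
    by rewrite cayley_boundary_path_chain w1 mulg1 subrr.
  by have [c c_w] := presD _ cycle_w; exists c.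
have [c cP] := choice fill.
have [M MP] := bounded_on_short_words (fun w => chain_norm (c w)) N.
exists M => g w le_wN w1; exists (translate g (c w)); split.
  by rewrite relator_boundary_translate cP // translate_path_chain mulg1.
rewrite (leq_trans _ (MP w le_wN)) // -[leqRHS]mul1n.
by apply: chain_norm_linext => x; rewrite chain_normU.
Qed.

End Filling.

(** * Comparison of fillings *)

(** The chain homotopy argument: f is the map induced by phi, and a filling c of
f z is pulled back to h z + f' c, where f' is the map induced by psi and h the
homotopy from f' f to the identity. *)
Lemma filling_pull_back (G H : groupType) (D : hpres_data G) (D' : hpres_data H)
    (phi : G -> H) (psi : H -> G) :
  homological_finite_presentation D ->
  word_lipschitz (gens D) (gens D') phi ->
  word_lipschitz (gens D') (gens D) psi ->
  word_close (gens D) (psi \o phi) ->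
  exists (f : {malg int[(G * gens D)%type]} -> {malg int[(H * gens D')%type]})
         (K M : nat),
    forall z, (chain_norm (f z) <= K * chain_norm z)%N /\
      (cayley_boundary z = 0 ->
       cayley_boundary (f z) = 0 /\
       forall c, relator_boundary c = f z ->
       exists c', relator_boundary c' = z /\
         (chain_norm c' <= M * chain_norm c + M * chain_norm z)%N).
Proof.
move=> presD [K phiP] [K' psiP] [L closeP].
have [u uP] := choice (fun e : G * gens D => phiP e.1 e.2).
have [v vP] := choice (fun e : H * gens D' => psiP e.1 e.2).
have [t tP] := choice closeP.
have u_val e := (uP e).1; have u_size e := (uP e).2.
have v_val e := (vP e).1; have v_size e := (vP e).2.
have t_val g := (tP g).1; have t_size g := (tP g).2.
pose f := push1 phi u; pose f' := push1 psi v.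
pose N := (\max_(r : rels D') size (val r))%N.
have [M1 M1P] := loop_filling_bounded presD (K' * N)%N.
(* Faces of Y: the image of an attaching path is a closed path of length at most
   K' * N, which is filled in X. *)
have fill_face (s : H * rels D') : exists c : {malg int[(G * rels D)%type]},
    relator_boundary c = f' (path_chain s.1 (val s.2)) /\
    (chain_norm c <= M1)%N.
  case: s => h r; rewrite /f' /=.
  have [w [w_val w_size ->]] := push1_path_chain v_val v_size h (val r).
  apply: M1P; last first.
    by rewrite w_val (rels_trivial (valP r)) mulg1 mulVg.
  rewrite (leq_trans w_size) // leq_mul2l.
  by rewrite (@leq_bigmax (rels D') (fun r => size (val r))) orbT.
have [g2 g2P] := choice fill_face.
(* Edges e of X: the square has the sides e, f' (f e) of length at most K' * K,
   and the two paths T from psi (phi g) to g of length at most L. *)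
have [M2 M2P] := loop_filling_bounded presD (L + 1 + L + K' * K)%N.
pose T g := path_chain (psi (phi g)) (t g).
have fill_square (e : G * gens D) : exists c : {malg int[(G * rels D)%type]},
    relator_boundary c =
      T (cayley_src e) + << e >> - T (cayley_tgt e) - f' (f << e >>) /\
    (chain_norm c <= M2)%N.
  case: e => g a.
  rewrite /cayley_src /cayley_tgt /=.
  rewrite /f /push1 linextU /=.
  have [w [w_val w_size f'_u]] :=
    push1_path_chain v_val v_size (phi g) (u (g, a)).
  rewrite u_val /= mulVKg in w_val.
  pose loop := t g ++ [:: (a, true)] ++ word_inv (t (g * val a)%g)
    ++ word_inv w.
  have end_t k : (psi (phi k) * word_val (t k) = k)%g.
    by rewrite t_val /= mulVKg.
  have back k : path_chain k (word_inv (t k)) = - T k.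
    by rewrite -{1}(end_t k) path_chain_inv.
  have end_back k : (k * word_val (word_inv (t k)) = psi (phi k))%g.
    by rewrite word_val_inv -{1}(end_t k) mulgK.
  have loop_chain : path_chain (psi (phi g)) loop =
      T g + << (g, a) >> - T (g * val a)%g - f' (path_chain (phi g) (u (g, a))).
    rewrite /loop !path_chain_cat end_t path_chain_letter !addrA.
    have -> : word_val [:: (a, true)] = val a.
      by rewrite word_val_cons word_val_nil mulg1.
    rewrite back end_back.
    have -> : psi (phi (g * val a)%g) = (psi (phi g) * word_val w)%g.
      by rewrite w_val mulVKg.
    by rewrite path_chain_inv -f'_u.
  rewrite -loop_chain; apply: M2P.
    rewrite /loop !size_cat !size_word_inv -!addnA !leq_add //.
    by rewrite (leq_trans w_size) // leq_mul.
  rewrite /loop !word_val_cat !word_val_inv word_val_cons word_val_nil mulg1.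
  by rewrite !t_val w_val /= /letter_val /= !invgM !invgK !mulgA !mulgK mulVg.
have [h hP] := choice fill_square.
exists f, K, (M1 + M2)%N => z; split; first exact: chain_norm_push1.
move=> cycle_z; split.
  by rewrite cayley_boundary_push1 // cycle_z linext0.
move=> c c_fz; exists (linext h z + linext g2 c); split.
  have faces_c : relator_boundary (linext g2 c) = f' (f z).
    rewrite /relator_boundary linext_comp (eq_linext _ (fun s => (g2P s).1)).
    by rewrite /f' /push1 -linext_comp -/(relator_boundary c) c_fz.
  (* The sides of the squares cancel along z because z is a cycle. *)
  have T_ends : linext (fun e => T (cayley_src e)) z =
      linext (fun e => T (cayley_tgt e)) z.
    apply/esym/subr0_eq; rewrite -linext_oppf -linext_addf.
    rewrite -[RHS](linext0 T) -cycle_z /cayley_boundary linext_comp.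
    by apply: eq_linext => e; rewrite linextB !linextU.
  have ff_z : linext (fun e => f' (f << e >>)) z = f' (f z).
    rewrite /f' /f /push1 linext_comp.
    by apply: eq_linext => e; rewrite linextU.
  have squares_z : relator_boundary (linext h z) = z - f' (f z).
    rewrite /relator_boundary linext_comp (eq_linext _ (fun e => (hP e).1)).
    rewrite !linext_addf !linext_oppf linext_id ff_z T_ends.
    by rewrite [_ + z]addrC addrK.
  by rewrite /relator_boundary linextD -!/(relator_boundary _) squares_z
    faces_c subrK.
rewrite (leq_trans (chain_normD _ _)) // addnC leq_add //.
  apply: (leq_trans (chain_norm_linext _ (fun s => (g2P s).2))).
  by rewrite leq_mul2r leq_addr orbT.
apply: (leq_trans (chain_norm_linext _ (fun s => (hP s).2))).
by rewrite leq_mul2r leq_addl orbT.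
Qed.

(** The filling function of the target is at least the area m of f z; that area
is attained by a chain c because H_1 of the target vanishes.  As |f z| is at most
K |z|, the argument is rescaled by K + 1, the successor making it positive even
when K = 0; likewise for the factor M + 1. *)
Lemma growth_le_homological_dehn (R : realType) (G H : groupType)
    (D : hpres_data G) (D' : hpres_data H) (phi : G -> H) (psi : H -> G) :
  homological_finite_presentation D ->
  homological_finite_presentation D' ->
  word_lipschitz (gens D) (gens D') phi ->
  word_lipschitz (gens D') (gens D) psi ->
  word_close (gens D) (psi \o phi) ->
  growth_le (@homological_dehn R G D) (@homological_dehn R H D').
Proof.
move=> presD presD' phi_lip psi_lip close.
have [f [K [M fP]]] := filling_pull_back presD phi_lip psi_lip close.
exists M.+1%:R, K.+1%:R, 0, M%:R, 0; split.
  by split; rewrite ?ltr0Sn ?ler0n.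
move=> x x0; rewrite !addr0 /homological_dehn /step_extension.
apply: ge_ereal_sup => _ [z [cycle_z z_le] <-].
have [norm_fz /(_ cycle_z) [cycle_fz pull]] := fP z.
have fillable : exists m, `[< exists c,
    relator_boundary c = f z /\ chain_norm c = m >].
  have [c c_fz] := presD' _ cycle_fz.
  by exists (chain_norm c); apply/asboolP; exists c.
case: (ex_minnP fillable) => m /asboolP [c [c_fz c_m]] m_min.
have [c' [c'_z c'_norm]] := pull c c_fz.
have Kx0 : 0 <= K.+1%:R * x by rewrite mulr_ge0 ?ler0n.
have nx : (Num.truncn x)%:R <= x by rewrite -truncn_ge_nat.
have z_x : (chain_norm z)%:R <= x :> R.
  by rewrite (le_trans _ nx) // ler_nat.
have fz_le : (chain_norm (f z) <= Num.truncn (K.+1%:R * x))%N.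
  rewrite truncn_ge_nat // (@le_trans _ _ (K * chain_norm z)%:R) ?ler_nat //.
  by rewrite natrM ler_pM ?ler0n // ler_nat.
have area_fz : (m%:R%:E <= FA (presentation_complex D') R
    (Num.truncn (K.+1%:R * x)))%E.
  apply: (@le_trans _ _ (HArea (X := presentation_complex D') R (f z))).
    apply: le_ereal_inf_tmp => _ [b b_fz <-]; rewrite lee_fin ler_nat.
    by apply: m_min; apply/asboolP; exists b.
  by apply: ereal_sup_ubound; exists (f z).
apply: (@le_trans _ _ (M.+1%:R * m%:R + M%:R * x)%:E); last first.
  by rewrite EFinD leeD // EFinM lee_pmul2l // lte_fin ltr0Sn.
apply: (@le_trans _ _ (chain_norm c')%:R%:E).
  by apply: ereal_inf_lbound; exists c'.
rewrite lee_fin (@le_trans _ _ (M * m + M * chain_norm z)%:R) ?ler_nat -?c_m //.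
rewrite natrD !natrM; apply: lerD; last by rewrite ler_wpM2l ?ler0n.
by rewrite ler_wpM2r ?ler0n // ler_nat.
Qed.

Theorem theorem2p36 (R : realType) (G H : groupType)
    (FP2_G : type_FP2 G) (FP2_H : type_FP2 H)
    (qi_GH : quasi_isometric R G H)
    (D : hpres_data G) (D' : hpres_data H)
    (presD : homological_finite_presentation D)
    (presD' : homological_finite_presentation D') :
  growth_equiv (homological_dehn R D) (homological_dehn R D').
Proof.
have [phi [psi [phi_lip psi_lip close_G close_H]]] :=
  quasi_isometry_words (gens_generate D) (gens_generate D') qi_GH.
by split; [apply: growth_le_homological_dehn close_G
          | apply: growth_le_homological_dehn close_H].
Qed.
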